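(* Let $(R,\mathfrak m)$ be a Noetherian local ring of dimension $2$ with infinite residue field $R/\mathfrak m$, and let $J=(x,y)$ be a parameter ideal. Let $\mathcal J=\{J_n\}_{n\in\mathbb Z}$ be a $J$-admissible filtration such that $\operatorname{depth} G(\mathcal J)\ge 1$ and the image $x^*\in J_1/J_2$ of $x$ is a nonzerodivisor in $G(\mathcal J)$. Then $$e_1(\mathcal J)=\sum_{n\ge 1}\left[\lambda\left(\frac{J_n}{JJ_{n-1}}\right)-\lambda\left(\frac{(x:y)\cap J_{n-1}}{(x)J_{n-2}}\right)\right].$$
   Context: Conventions: $\lambda$ denotes length as an $R$-module, $J^n=R$ for $n\le 0$, and $(x:y)=\{r\in R: ry\in (x)\}$. A parameter ideal is an ideal generated by a system of parameters of $R$. A sequence of ideals $\mathcal J=\{J_n\}_{n\in\mathbb Z}$ is a $J$-admissible filtration if there is $k\in\mathbb N$ such that for all $m,n\in\mathbb Z$: $J_{n+1}\subseteq J_n$, $J_mJ_n\subseteq J_{m+n}$, and $J^n\subseteq J_n\subseteq J^{n-k}$. In particular $J_n=R$ for $n\le 0$. The associated graded ring is $G(\mathcal J)=\bigoplus_{n\ge 0}J_n/J_{n+1}$; its depth is taken with respect to its unique homogeneous maximal ideal. For $\dim R=2$, the Hilbert function $H_{\mathcal J}(n)=\lambda(R/J_n)$ agrees for large $n$ with a polynomial $$P_{\mathcal J}(n)=e_0(\mathcal J)\binom{n+1}{2}-e_1(\mathcal J)\,n+e_2(\mathcal J)$$ with integers $e_i(\mathcal J)$; $e_1(\mathcal J)$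 is called the Chern number of $\mathcal J$. *)

(* Defs.v *)
From HB Require Import structures.
From mathcomp Require Import all_boot all_order all_algebra.
From mathcomp Require Import generic_quotient ring_quotient.
From mathcomp Require Import boolp classical_sets cardinality.

Set Implicit Arguments.
Unset Strict Implicit.
Unset Printing Implicit Defensive.

Import GRing.Theory.
Local Open Scope classical_set_scope.
Local Open Scope ring_scope.

Definition is_max (P : set nat) (d : nat) : Prop :=
  P d /\ forall k, P k -> (k <= d)%N.

(* Equal to 0 when P has no largest element. *)
Definition max_nat (P : set nat) : nat := xget 0%N [set d | is_max P d].

Section Ideals.
Variable A : comPzRingType.
Implicit Types (I K L N : set A) (s : seq A).

Definition is_ideal I : Prop :=
  [/\ I 0, forall a b, I a -> I b -> I (a + b) & forall r a, I a -> I (r * a)].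

Definition ideal_span (X : set A) : set A := smallest is_ideal X.

Definition idealM I K : set A :=
  ideal_span [set z | exists a b, [/\ I a, K b & z = a * b]].

(* I ^ n for an integer exponent; the unit ideal for n <= 0. *)
Definition idealX I (n : int) : set A :=
  if n is Posz k then iter k (idealM I) setT else setT.

Definition colon (a b : A) : set A := [set r | ideal_span [set a] (r * b)].

Definition radical I : set A := [set a | exists n : nat, I (a ^+ n)].

Definition maximal_ideal I : Prop :=
  [/\ is_ideal I, ~ I 1 & forall K, is_ideal K -> ~ K 1 -> I `<=` K -> K = I].

Definition prime_ideal I : Prop :=
  [/\ is_ideal I, ~ I 1 & forall a b, I (a * b) -> I a \/ I b].

Definition noetherian : Prop :=
  forall I, is_ideal I -> exists s, I = ideal_span [set` s].

(* The ring is local with maximal ideal m. *)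
Definition local_ring (m : set A) : Prop :=
  maximal_ideal m /\ forall m', maximal_ideal m' -> m' = m.

(* The cosets a + I, i.e. the elements of A / I. *)
Definition cosets I : set (set A) :=
  [set C | exists a, C = [set a + u | u in I]].

Definition prime_chain (l : nat) : Prop :=
  exists c : nat -> set A, (forall i, (i <= l)%N -> prime_ideal (c i)) /\
    (forall i, (i < l)%N -> c i `<` c i.+1).

Definition krull_dim_is (d : nat) : Prop := is_max prime_chain d.

(* For m the maximal ideal of a local ring, radical I = m says that I is
   m-primary. *)
Definition system_of_parameters (m : set A) s : Prop :=
  krull_dim_is (size s) /\ radical (ideal_span [set` s]) = m.

(* By the correspondence theorem, the chains of submodules of L / N from 0 to
   L / N are the chains of ideals of A from N to L.  There is no such chain
   unless N is contained in L. *)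
Definition subquo_chain L N (l : nat) : Prop :=
  exists c : nat -> set A,
    [/\ c 0%N = N, c l = L, forall i, (i <= l)%N -> is_ideal (c i)
      & forall i, (i < l)%N -> c i `<` c i.+1].

Definition finite_length L N : Prop := exists l, is_max (subquo_chain L N) l.

(* The length of the A-module L / N, when it is finite; see finite_length. *)
Definition subquo_length L N : nat := max_nat (subquo_chain L N).

Definition regular_seq s : Prop :=
  (forall i, (i < size s)%N -> forall a,
     ideal_span [set` take i s] (s`_i * a) -> ideal_span [set` take i s] a) /\
  ~ ideal_span [set` s] 1.

(* The depth of A with respect to I: the largest length of a regular sequence
   in I.  It is attained when A is Noetherian and I is proper. *)
Definition depth I : nat :=
  max_nat [set d | exists s, [/\ size s = d, regular_seq s & [set` s] `<=` I]].

End Ideals.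

Arguments noetherian A : clear implicits.
Arguments krull_dim_is A d : clear implicits.

Record filtration (R : comNzRingType) := Filtration {
  fil :> int -> set R;
  fil_ideal : forall n, is_ideal (fil n);
  fil_dec : forall n, fil (n + 1) `<=` fil n;
  fil_mul : forall m n a b, fil m a -> fil n b -> fil (m + n) (a * b);
  fil0 : fil 0 = setT }.

(* F_0 = R, a field of the record so that the Rees ring is defined for every
   filtration, also follows from the inclusion J^0 `<=` F_0 below. *)
Definition admissible (R : comNzRingType) (J : set R) (F : filtration R) : Prop :=
  exists k : nat, forall n : int,
    idealX J n `<=` F n /\ F n `<=` idealX J (n - k%:Z).

(* The associated graded ring is built as the quotient of the Rees ring
   (+)_n F_n t^n, a subring of R[t], by its ideal (+)_n F_(n+1) t^n. *)
Section AssociatedGraded.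
Variables (R : comNzRingType) (F : filtration R).

Definition rees_pred : {pred {poly R}} :=
  [pred p : {poly R} | `[< forall n : nat, F n%:Z p`_n >]].

Lemma fil_0 n : F n 0. Proof. by case: (fil_ideal F n). Qed.

Lemma fil_add n a b : F n a -> F n b -> F n (a + b).
Proof. by case: (fil_ideal F n) => _ + _; exact. Qed.

Lemma fil_mull n r a : F n a -> F n (r * a).
Proof. by case: (fil_ideal F n) => _ _; exact. Qed.

Lemma fil_opp n a : F n a -> F n (- a).
Proof. by rewrite -mulN1r; exact: fil_mull. Qed.

Lemma fil_sum n (T : Type) (r : seq T) (G : T -> R) :
  (forall i, F n (G i)) -> F n (\sum_(i <- r) G i).
Proof. by move=> FG; elim/big_ind: _ => //; [exact: fil_0 | exact: fil_add]. Qed.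

Lemma rees_subring : subring_closed rees_pred.
Proof.
split=> [|p q /asboolP Fp /asboolP Fq|p q /asboolP Fp /asboolP Fq].
- apply/asboolP => -[|n]; first by rewrite fil0.
  by rewrite coef1; exact: fil_0.
- apply/asboolP => n; rewrite coefB; apply: fil_add => //.
  exact: fil_opp.
- apply/asboolP => n; rewrite coefM; apply: fil_sum => i.
  have -> : n%:Z = (i : nat)%:Z + (n - i)%N%:Z.
    by rewrite -PoszD subnKC // -ltnS.
  exact: fil_mul.
Qed.

HB.instance Definition _ :=
  GRing.isSubringClosed.Build {poly R} rees_pred rees_subring.

Record rees := Rees { rees_val : {poly R}; reesP : rees_val \in rees_pred }.

HB.instance Definition _ := [isSub for rees_val].
HB.instance Definition _ := [Choice of rees by <:].
HB.instance Definition _ := [SubChoice_isSubComNzRing of rees by <:].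

Definition rees_shift : {pred rees} :=
  [pred p : rees | `[< forall n : nat, F (n%:Z + 1) (val p)`_n >]].

Lemma rees_shift_zmod : zmod_closed rees_shift.
Proof.
split=> [|p q /asboolP Fp /asboolP Fq]; apply/asboolP => n.
  by rewrite raddf0 coef0; exact: fil_0.
rewrite raddfB coefB; apply: fil_add => //; exact: fil_opp.
Qed.

HB.instance Definition _ :=
  GRing.isZmodClosed.Build rees rees_shift rees_shift_zmod.

Lemma rees_shiftM p q : q \in rees_shift -> p * q \in rees_shift.
Proof.
have /asboolP Fp := reesP p; move=> /asboolP Fq; apply/asboolP => n.
rewrite rmorphM /= coefM; apply: fil_sum => i.
have -> : n%:Z + 1 = (i : nat)%:Z + ((n - i)%N%:Z + 1).
  by rewrite addrA; congr (_ + _); rewrite -PoszD subnKC // -ltnS.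
exact: fil_mul.
Qed.

Definition gr := Quotient.quot rees_shift.
HB.instance Definition _ := GRing.Zmodule.on gr.

Definition to_gr (p : rees) : gr := \pi_(Quotient.quot rees_shift)%qT p.

Definition gr_mul (a b : gr) : gr :=
  to_gr (repr (a : Quotient.quot rees_shift) *
         repr (b : Quotient.quot rees_shift)).

Lemma to_grE p q : (to_gr p = to_gr q) <-> (p - q \in rees_shift).
Proof. by rewrite Quotient.idealrBE; split=> /eqP. Qed.

Lemma to_gr_mul p q : gr_mul (to_gr p) (to_gr q) = to_gr (p * q).
Proof.
apply/to_grE; set p' := repr _; set q' := repr _.
have hp : p' - p \in rees_shift by apply/to_grE; rewrite /to_gr reprK.
have hq : q' - q \in rees_shift by apply/to_grE; rewrite /to_gr reprK.
have -> : p' * q' - p * q = p' * (q' - q) + q * (p' - p).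
  by rewrite !mulrBr addrA (mulrC q p') subrK (mulrC q p).
by rewrite rpredD // rees_shiftM.
Qed.

Lemma to_grP (a : gr) : exists p, a = to_gr p.
Proof. by exists (repr (a : Quotient.quot rees_shift)); rewrite /to_gr reprK. Qed.

Lemma to_grD p q : to_gr (p + q) = to_gr p + to_gr q.
Proof. exact: (raddfD (\pi_(Quotient.quot rees_shift)%qT)). Qed.

Lemma gr_mulA : associative gr_mul.
Proof.
move=> a b c; case: (to_grP a) (to_grP b) (to_grP c) => p -> [q ->] [r ->].
by rewrite !to_gr_mul mulrA.
Qed.

Lemma gr_mulC : commutative gr_mul.
Proof.
move=> a b; case: (to_grP a) (to_grP b) => p -> [q ->].
by rewrite !to_gr_mul mulrC.
Qed.

Lemma gr_mul1 : left_id (to_gr 1) gr_mul.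
Proof. by move=> a; case: (to_grP a) => p ->; rewrite to_gr_mul mul1r. Qed.

Lemma gr_mulDl : left_distributive gr_mul +%R.
Proof.
move=> a b c; case: (to_grP a) (to_grP b) (to_grP c) => p -> [q ->] [r ->].
by rewrite -to_grD !to_gr_mul mulrDl to_grD.
Qed.

HB.instance Definition _ :=
  GRing.Zmodule_isComPzRing.Build gr gr_mulA gr_mulC gr_mul1 gr_mulDl.

(* The image in F_n / F_(n+1) of an element a of F_n, as an element of degree n
   of the associated graded ring.  (Junk value 0 if a is not in F_n.) *)
Definition initial_form (n : nat) (a : R) : gr := to_gr (insubd 0 (a *: 'X^n)).

(* (m / F_1) (+) (+)_(n >= 1) F_n / F_(n+1): the homogeneous maximal ideal of
   the associated graded ring when (R, m) is local and F_1 is proper. *)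
Definition gr_max (m : set R) : set gr :=
  [set a | exists p : rees, a = to_gr p /\ m (val p)`_0].

End AssociatedGraded.

Arguments gr_max {R} F m.

(* e = (e_0, e_1, e_2); the ring R is meant to have dimension 2. *)
Definition hilbert_coeffs (R : comNzRingType) (F : filtration R)
    (e : int * int * int) : Prop :=
  let: (e0, e1, e2) := e in
  exists N : nat, forall n : nat, (N <= n)%N ->
    finite_length setT (F n%:Z) /\
    (subquo_length setT (F n%:Z))%:Z = e0 * 'C(n.+1, 2)%:Z - e1 * n%:Z + e2.

Definition chern_number (R : comNzRingType) (F : filtration R) : int :=
  let: (_, e1, _) := xget (0, 0, 0) [set e | hilbert_coeffs F e] in e1.

(* s is the sum of the series f 1 + f 2 + ..., all but finitely many terms of
   which vanish. *)
Definition is_sum_from1 (f : nat -> int) (s : int) : Prop :=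
  exists N : nat, forall M : nat, (N <= M)%N -> \sum_(1 <= n < M) f n = s.

(* Main.v *)
(* Let B_n = F_n + (x), L(n) = l(R/B_n), W = (x : y) and
   c = l(R/J) - l(W/(x)).  As x^* is regular, F_(n+1) : x = F_n, so that
   H(n+1) = L(n+1) + H(n).  For every ideal B containing (x) with l(R/B) finite,
   multiplication by y gives
     l(B/(yB + (x))) - l((W /\ B)/(x)) = c,
   and taking B = B_n shows that the summand of index n + 1 is c - L(n+1) + L(n).
   The partial sums are therefore c n - L(n).  With B = Y_n = (y^n) + (x) the same
   identity gives l(R/Y_n) >= c n, and F_(k+n) is contained in Y_n, so the partial
   sums are bounded above by c k.  Since W /\ Y_n = (x) for n large (the chain of
   the (x) : y^n is stationary), the summands are eventually nonnegative, hence
   eventually zero.  Thus L(n) = c n - e_1 for n large, where e_1 is the sum of the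
   series, and summing gives the Hilbert polynomial with Chern number e_1. *)
Require Import Defs.
From mathcomp Require Import all_boot all_order all_algebra.
From mathcomp Require Import boolp classical_sets cardinality.
From mathcomp Require Import zify ring.

Import Order.TTheory GRing.Theory Num.Theory.

Local Open Scope classical_set_scope.
Local Open Scope ring_scope.

(** * Sums, multiples, colons and products of ideals *)

Section IdealArithmetic.
Context {A : comPzRingType}.
Implicit Types (I K L M N : set A) (a b : A).

Definition addI I K : set A := [set z | exists a b, [/\ I a, K b & z = a + b]].

Definition scaleI a I : set A := [set a * b | b in I].

Definition colonI N a : set A := [set r | N (r * a)].

Lemma ideal0 {I} : is_ideal I -> I 0.
Proof. by case. Qed.

Lemma idealD {I} a b : is_ideal I -> I a -> I b -> I (a + b).
Proof. by case=> _ + _; exact. Qed.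

Lemma idealMl {I} a b : is_ideal I -> I b -> I (a * b).
Proof. by case=> _ _; exact. Qed.

Lemma idealMr {I} a b : is_ideal I -> I a -> I (a * b).
Proof. by rewrite mulrC; exact: idealMl. Qed.

Lemma idealB {I} a b : is_ideal I -> I a -> I b -> I (a - b).
Proof. by move=> iI Ia Ib; rewrite -mulN1r; apply: idealD => //; exact: idealMl. Qed.

Lemma ideal_setT : is_ideal (@setT A).
Proof. by []. Qed.

Lemma idealI {I K} : is_ideal I -> is_ideal K -> is_ideal (I `&` K).
Proof.
move=> iI iK; split; first by split; exact: ideal0.
- by move=> a b [Ia Ka] [Ib Kb]; split; exact: idealD.
- by move=> r a [Ia Ka]; split; exact: idealMl.
Qed.

Lemma ideal_span_ideal (X : set A) : is_ideal (ideal_span X).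
Proof.
split=> [I [iI _]|a b Xa Xb I [iI XI]|r a Xa I [iI XI]]; first exact: ideal0.
- by apply: idealD => //; [exact: Xa | exact: Xb].
- by apply: idealMl => //; exact: Xa.
Qed.

Lemma sub_ideal_span (X : set A) : X `<=` ideal_span X.
Proof. exact: sub_gen_smallest. Qed.

Lemma ideal_span_min (X : set A) I : is_ideal I -> X `<=` I -> ideal_span X `<=` I.
Proof. by move=> iI XI; exact: smallest_sub. Qed.

Lemma addI_ideal {I K} : is_ideal I -> is_ideal K -> is_ideal (addI I K).
Proof.
move=> iI iK; split.
- by exists 0, 0; split; [exact: ideal0|exact: ideal0|rewrite addr0].
- move=> _ _ [a [b [Ia Kb ->]]] [a' [b' [Ia' Kb' ->]]].
  by exists (a + a'), (b + b'); split; [exact: idealD|exact: idealD|rewrite addrACA].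
- move=> r _ [a [b [Ia Kb ->]]].
  by exists (r * a), (r * b); split; [exact: idealMl|exact: idealMl|rewrite mulrDr].
Qed.

Lemma subset_addIl I K : is_ideal K -> I `<=` addI I K.
Proof. by move=> iK a Ia; exists a, 0; split=> //; [exact: ideal0|rewrite addr0]. Qed.

Lemma subset_addIr I K : is_ideal I -> K `<=` addI I K.
Proof. by move=> iI a Ka; exists 0, a; split=> //; [exact: ideal0|rewrite add0r]. Qed.

Lemma addI_min I K L : is_ideal L -> I `<=` L -> K `<=` L -> addI I K `<=` L.
Proof. by move=> iL IL KL _ [a [b [Ia Kb ->]]]; apply: idealD; [|exact: IL|exact: KL]. Qed.

Lemma addISl I I' K : I `<=` I' -> addI I K `<=` addI I' K.
Proof. by move=> II' _ [a [b [Ia Kb ->]]]; exists a, b; split=> //; exact: II'. Qed.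

Lemma addI_idl I K : is_ideal I -> is_ideal K -> K `<=` I -> addI I K = I.
Proof.
by move=> iI iK KI; apply/seteqP; split; [exact: addI_min|exact: subset_addIl].
Qed.

Lemma scaleI_ideal {I} a : is_ideal I -> is_ideal (scaleI a I).
Proof.
move=> iI; split.
- by exists 0; [exact: ideal0|rewrite mulr0].
- move=> _ _ [b Ib <-] [c Ic <-]; exists (b + c); last by rewrite mulrDr.
  exact: idealD.
- move=> r _ [b Ib <-]; exists (r * b); last by rewrite mulrCA.
  exact: idealMl.
Qed.

Lemma scaleIS a I K : I `<=` K -> scaleI a I `<=` scaleI a K.
Proof. exact: image_subset. Qed.

Lemma scaleI_sub {I} K a : is_ideal I -> I a -> scaleI a K `<=` I.
Proof. by move=> iI Ia _ [b _ <-]; exact: idealMr. Qed.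

Lemma scaleI_sub_id {I} a : is_ideal I -> scaleI a I `<=` I.
Proof. by move=> iI _ [b Ib <-]; exact: idealMl. Qed.

Lemma ideal_span1 a : ideal_span [set a] = scaleI a setT.
Proof.
apply/seteqP; split.
  apply: ideal_span_min; first exact: scaleI_ideal.
  by move=> _ ->; exists 1 => //; rewrite mulr1.
apply: scaleI_sub; first exact: ideal_span_ideal.
exact: sub_ideal_span.
Qed.

Lemma ideal_span2 a b : ideal_span [set a; b] = addI (scaleI b setT) (scaleI a setT).
Proof.
have iS c : is_ideal (scaleI c setT) by exact: scaleI_ideal.
apply/seteqP; split.
  apply: ideal_span_min; first exact: addI_ideal.
  move=> _ [->|->]; [apply: subset_addIr => //|apply: subset_addIl => //];
    by exists 1 => //; rewrite mulr1.
have iJ := ideal_span_ideal [set a; b].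
by apply: addI_min => //; apply: scaleI_sub => //; apply: sub_ideal_span; [right|left].
Qed.

Lemma colonI_ideal {N} a : is_ideal N -> is_ideal (colonI N a).
Proof.
move=> iN; split; rewrite /colonI /=.
- by rewrite mul0r; exact: ideal0.
- by move=> r s Nr Ns; rewrite mulrDl; exact: idealD.
- by move=> r s Ns; rewrite -mulrA; exact: idealMl.
Qed.

Lemma subset_colonI {N} a : is_ideal N -> N `<=` colonI N a.
Proof. by move=> iN b Nb; exact: idealMr. Qed.

Lemma idealM_ideal I K : is_ideal (idealM I K).
Proof. exact: ideal_span_ideal. Qed.

Lemma mem_idealM {I K} a b : I a -> K b -> idealM I K (a * b).
Proof. by move=> Ia Kb; apply: sub_ideal_span; exists a, b. Qed.

Lemma idealM_min I K L : is_ideal L ->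
  (forall a b, I a -> K b -> L (a * b)) -> idealM I K `<=` L.
Proof. by move=> iL H; apply: ideal_span_min => // _ [a [b [Ia Kb ->]]]; exact: H. Qed.

Lemma idealM_span1 a I : is_ideal I -> idealM (ideal_span [set a]) I = scaleI a I.
Proof.
move=> iI; apply/seteqP; split.
  apply: idealM_min; first exact: scaleI_ideal.
  rewrite ideal_span1 => _ c [r _ <-] Ic; exists (r * c); last by rewrite mulrA.
  exact: idealMl.
by move=> _ [b Ib <-]; apply: mem_idealM => //; exact: sub_ideal_span.
Qed.

Lemma idealM_span2 a b I : is_ideal I ->
  idealM (ideal_span [set a; b]) I = addI (scaleI b I) (scaleI a I).
Proof.
move=> iI; have iS c : is_ideal (scaleI c I) by exact: scaleI_ideal.
apply/seteqP; split.
  apply: idealM_min; first exact: addI_ideal.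
  rewrite ideal_span2 => _ c [_ [_ [[r _ <-] [s _ <-] ->]]] Ic.
  exists (b * (r * c)), (a * (s * c)); split; last by rewrite mulrDl !mulrA.
    by exists (r * c) => //; exact: idealMl.
  by exists (s * c) => //; exact: idealMl.
apply: addI_min; first exact: idealM_ideal.
  by move=> _ [c Ic <-]; apply: mem_idealM => //; apply: sub_ideal_span; right.
by move=> _ [c Ic <-]; apply: mem_idealM => //; apply: sub_ideal_span; left.
Qed.

(** * Chains of ideals *)

Inductive ideal_chain N : set A -> nat -> Prop :=
| ideal_chain0 : is_ideal N -> ideal_chain N N 0
| ideal_chainS K L l :
    ideal_chain N K l -> is_ideal L -> K `<` L -> ideal_chain N L l.+1.

(** The inductive form grows a chain at its upper end, so that chains can be extended, concatenated,
    mapped and split by induction instead of by reindexing a function. *)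
Lemma subquo_chainE L N : subquo_chain L N = ideal_chain N L.
Proof.
apply/predeqP => l; split.
  elim: l L => [|l IH] L [c [c0 cl ic lc]].
    by rewrite -cl -c0; apply: ideal_chain0; exact: ic.
  rewrite -cl; apply: (@ideal_chainS _ (c l)); [|exact: ic|exact: lc].
  by apply: IH; exists c; split=> // i il; [apply: ic|apply: lc]; exact: leqW.
elim=> [iN|K {}L {}l _ [c [c0 cl ic lc]] iL KL].
  by exists (fun=> N).
exists (fun i => if (i <= l)%N then c i else L); split=> //; first by rewrite ltnn.
- by move=> i _; case: ifP => // il; exact: ic.
- move=> i; rewrite ltnS => /= il; rewrite il; case: ltnP => [/lc//|li].
  by have -> : i = l; [lia|rewrite cl].
Qed.

Lemma ideal_chain_idealr N L l : ideal_chain N L l -> is_ideal L.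
Proof. by case. Qed.

Lemma ideal_chain_ideall N L l : ideal_chain N L l -> is_ideal N.
Proof. by elim. Qed.

Lemma ideal_chain_sub N L l : ideal_chain N L l -> N `<=` L.
Proof.
by elim=> [_|K {}L {}l _ NK _ [KL _]]; [exact: subset_refl|exact: subset_trans KL].
Qed.

Lemma ideal_chain_loop N l : ideal_chain N N l -> l = 0%N.
Proof.
suff gen L : ideal_chain N L l -> L `<=` N -> l = 0%N by move=> /gen; exact.
case=> // K {}L {}l NK _ [_ nLK] LN; case: nLK.
exact: subset_trans LN (ideal_chain_sub _ _ _ NK).
Qed.

(** Either [L] = [K] and the chain is kept, or one step is added. This absorbs inclusions not known
    to be strict. *)
Lemma ideal_chain_ext {N K L l} : ideal_chain N K l -> is_ideal L -> K `<=` L ->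
  exists2 l', ideal_chain N L l' & (l <= l')%N /\ (K `<` L -> (l < l')%N).
Proof.
move=> NK iL KL; have [LK|nLK] := pselect (L `<=` K).
  have <- : K = L by apply/seteqP.
  by exists l => //; split=> // -[].
by exists l.+1; [exact: ideal_chainS NK _ _|split].
Qed.

Lemma ideal_chain_cat {N M L k l} : ideal_chain N M k -> ideal_chain M L l ->
  ideal_chain N L (k + l).
Proof.
move=> NM; elim=> [_|K {}L {}l _ IH iL KL]; first by rewrite addn0.
by rewrite addnS; exact: ideal_chainS IH iL KL.
Qed.

(** Strictness is asked only between [N] and [L]: the maps used below (intersection, sum, colon,
    multiple) preserve strict inclusions only in such an interval. *)
Lemma ideal_chain_map (phi : set A -> set A) {N L l} :
  (forall K, is_ideal K -> is_ideal (phi K)) ->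
  (forall K K', is_ideal K -> is_ideal K' -> N `<=` K -> K `<` K' -> K' `<=` L ->
     phi K `<` phi K') ->
  ideal_chain N L l -> ideal_chain (phi N) (phi L) l.
Proof.
move=> iphi + NL; elim: NL => [iN _|K {}L {}l NK IH iL KL phiS].
  by apply: ideal_chain0; exact: iphi.
have iK := ideal_chain_idealr _ _ _ NK.
apply: (@ideal_chainS _ (phi K)); [apply: IH|exact: iphi|].
  by move=> K1 K2 i1 i2 NK1 K12 K2K; apply: phiS => //; exact: subset_trans (KL.1).
by apply: phiS => //; exact: ideal_chain_sub NK.
Qed.

(* Modular law: if [K `<` K'], then [K] and [K'] cannot have both the same
   intersection and the same sum with [M]. *)
Lemma ideal_chain_split M {N L l} : is_ideal M -> ideal_chain N L l ->
  exists l1 l2, [/\ ideal_chain (N `&` M) (L `&` M) l1,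
    ideal_chain (addI N M) (addI L M) l2 & (l <= l1 + l2)%N].
Proof.
move=> iM; elim=> [iN|K {}L {}l NK [l1 [l2 [c1 c2 le12]]] iL KL].
  exists 0%N, 0%N; split=> //; apply: ideal_chain0; first exact: idealI.
  exact: addI_ideal.
have [l1' c1' [le1 lt1]] := ideal_chain_ext c1 (idealI iL iM) (setSI KL.1).
have [l2' c2' [le2 lt2]] := ideal_chain_ext c2 (addI_ideal iL iM) (addISl _ _ _ KL.1).
exists l1', l2'; split=> //.
suff [/lt1|/lt2] : (K `&` M `<` L `&` M) \/ (addI K M `<` addI L M) by lia.
have [LK|nLK] := pselect (L `&` M `<=` K `&` M); last first.
  by left; split=> //; exact: setSI KL.1.
right; split; first exact: addISl KL.1.
move=> addLK; apply: KL.2 => z Lz.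
have iK := ideal_chain_idealr _ _ _ NK.
have [a [b [Ka Mb zE]]] : addI K M z by apply: addLK; exact: subset_addIl.
rewrite zE; apply: idealD => //; apply: (LK b _).1; split=> //.
by have -> : b = z - a; [rewrite zE addrC addKr|apply: idealB => //; exact: KL.1].
Qed.

(** * Finite length, additivity of length and isomorphism theorems *)

Lemma is_max_inj (P : set nat) k l : is_max P k -> is_max P l -> k = l.
Proof. by move=> [Pk mk] [Pl ml]; apply/eqP; rewrite eqn_leq mk // ml. Qed.

Lemma max_natE (P : set nat) d : is_max P d -> max_nat P = d.
Proof.
move=> dP; rewrite /max_nat; case: xgetP => [d' _ d'P|/(_ d)//].
exact: is_max_inj d'P dP.
Qed.

Lemma is_max_bounded (P : set nat) k u :
  P k -> (forall l, P l -> (l <= u)%N) -> exists d, is_max P d.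
Proof.
move=> Pk uP.
have exP : exists i, `[< P i >] by exists k; apply/asboolP.
have ubP i : `[< P i >] -> (i <= u)%N by move=> /asboolP; exact: uP.
case: (ex_maxnP exP ubP) => d /asboolP Pd maxd.
by exists d; split=> // l Pl; apply: maxd; apply/asboolP.
Qed.

Lemma finite_length_chain {L N} :
  finite_length L N -> ideal_chain N L (subquo_length L N).
Proof.
by move=> [l ml]; rewrite /subquo_length (max_natE _ _ ml) -subquo_chainE; case: ml.
Qed.

Lemma ideal_chain_le {L N l} :
  finite_length L N -> ideal_chain N L l -> (l <= subquo_length L N)%N.
Proof.
move=> [d md]; rewrite /subquo_length (max_natE _ _ md) -subquo_chainE.
by case: md => _; exact.
Qed.

(** The inclusion provides at least one chain, so the bounded set of lengths is nonempty and has a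
    maximum. *)
Lemma finite_length_bounded u {L N} : is_ideal N -> is_ideal L -> N `<=` L ->
  (forall l, ideal_chain N L l -> (l <= u)%N) -> finite_length L N.
Proof.
move=> iN iL NL ub; have [l c _] := ideal_chain_ext (ideal_chain0 _ iN) iL NL.
by apply: (@is_max_bounded _ l u); rewrite subquo_chainE.
Qed.

(** Intersecting the chain with [M] gives the lower part, adding [M] to it gives the upper part. *)
Lemma ideal_chain_trisect {N M L l} : is_ideal M -> N `<=` M -> M `<=` L ->
  ideal_chain N L l ->
  exists l1 l2, [/\ ideal_chain N M l1, ideal_chain M L l2 & (l <= l1 + l2)%N].
Proof.
move=> iM NM ML c; have [l1 [l2 []]] := ideal_chain_split M iM c.
have iN := ideal_chain_ideall _ _ _ c; have iL := ideal_chain_idealr _ _ _ c.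
rewrite (addI_idl _ _ iL iM ML) (setIidl NM) (setIidr ML).
have -> : addI N M = M.
  by apply/seteqP; split; [exact: addI_min|exact: subset_addIr].
by move=> c1 c2 le; exists l1, l2.
Qed.

Lemma finite_length_trans {N M L} : N `<=` M -> M `<=` L ->
  finite_length M N -> finite_length L M -> finite_length L N.
Proof.
move=> NM ML fMN fLM; have c1 := finite_length_chain fMN.
have c2 := finite_length_chain fLM.
have iM := ideal_chain_idealr _ _ _ c1.
apply: (finite_length_bounded (subquo_length M N + subquo_length L M)).
- exact: ideal_chain_ideall c1.
- exact: ideal_chain_idealr c2.
- exact: subset_trans ML.
- move=> l /(ideal_chain_trisect iM NM ML)[l1 [l2 [cNM cML le12]]].
  have := ideal_chain_le fMN cNM; have := ideal_chain_le fLM cML; lia.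
Qed.

Lemma finite_lengthl {N M L} : is_ideal M -> N `<=` M -> M `<=` L ->
  finite_length L N -> finite_length M N.
Proof.
move=> iM NM ML fLN; have c := finite_length_chain fLN.
apply: (finite_length_bounded (subquo_length L N)) => //.
  exact: ideal_chain_ideall c.
move=> l cNM; have iL := ideal_chain_idealr _ _ _ c.
have [l' c' [ll' _]] := ideal_chain_ext cNM iL ML.
exact: leq_trans ll' (ideal_chain_le fLN c').
Qed.

Lemma finite_lengthr {N M L} : is_ideal M -> N `<=` M -> M `<=` L ->
  finite_length L N -> finite_length L M.
Proof.
move=> iM NM ML fLN; have c := finite_length_chain fLN.
apply: (finite_length_bounded (subquo_length L N)) => //.
  exact: ideal_chain_idealr c.
move=> l cML; have iN := ideal_chain_ideall _ _ _ c.
have [l' c' _] := ideal_chain_ext (ideal_chain0 _ iN) iM NM.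
by have := ideal_chain_le fLN (ideal_chain_cat c' cML); lia.
Qed.

(** Concatenating two longest chains gives one inequality, splitting a longest chain at [M] the
    other. *)
Lemma subquo_lengthD {N M L} : is_ideal M -> N `<=` M -> M `<=` L ->
  finite_length L N -> subquo_length L N = (subquo_length L M + subquo_length M N)%N.
Proof.
move=> iM NM ML fLN.
have fLM := finite_lengthr iM NM ML fLN; have fMN := finite_lengthl iM NM ML fLN.
have := ideal_chain_le fLN
  (ideal_chain_cat (finite_length_chain fMN) (finite_length_chain fLM)).
have [l1 [l2 [c1 c2]]] := ideal_chain_trisect iM NM ML (finite_length_chain fLN).
have := ideal_chain_le fMN c1; have := ideal_chain_le fLM c2; lia.
Qed.

Lemma finite_length_id {N} : is_ideal N -> finite_length N N.
Proof.
by move=> iN; apply: (finite_length_bounded 0) => // l /ideal_chain_loop ->.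
Qed.

Lemma subquo_length_id {N} : is_ideal N -> subquo_length N N = 0%N.
Proof.
by move=> iN; exact: ideal_chain_loop (finite_length_chain (finite_length_id iN)).
Qed.

(** The second isomorphism theorem, as an equality of chain predicates so that finiteness and length
    both transfer by rewriting. The two maps are intersection with [I] and addition of [M]. *)
Lemma subquo_chain_addI I M : is_ideal I -> is_ideal M ->
  subquo_chain (addI I M) M = subquo_chain I (I `&` M).
Proof.
move=> iI iM; rewrite !subquo_chainE.
apply/predeqP => l; split.
  move/(ideal_chain_map (setI I)).
  rewrite (setIidl (subset_addIl I M iM)); apply => [K iK|K K' iK iK' MK KK' K'I].
    exact: idealI.
  split; first exact: setIS KK'.1.
  move=> sub; apply: KK'.2 => z K'z; have [a [b [Ia Mb zE]]] := K'I z K'z.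
  rewrite zE; apply: idealD => //; last exact: MK.
  apply: (sub a _).2; split=> //.
  have -> : a = z - b by rewrite zE addrK.
  by apply: idealB => //; apply: KK'.1; exact: MK.
move/(ideal_chain_map (addI^~ M)).
have -> : addI (I `&` M) M = M.
  by apply/seteqP; split; [apply: addI_min|apply: subset_addIr; exact: idealI].
apply => [K iK|K K' iK iK' MK KK' K'I]; first exact: addI_ideal.
split; first exact: addISl KK'.1.
move=> sub; apply: KK'.2 => z K'z.
have [a [b [Ka Mb zE]]] := sub z (subset_addIl _ _ iM _ K'z).
rewrite zE; apply: idealD => //; apply: MK; split=> //.
have -> : b = z - a by rewrite zE addrC addKr.
by apply: idealB => //; apply: K'I => //; exact: KK'.1.
Qed.

(** Multiplication by a induces an isomorphism from A/(N : a) to (aA + N)/N. On ideals it is K |->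
    aK + N, with inverse K |-> (K : a). *)
Lemma subquo_chain_scaleI a N : is_ideal N ->
  subquo_chain (addI (scaleI a setT) N) N = subquo_chain setT (colonI N a).
Proof.
move=> iN; have iaT := scaleI_ideal a ideal_setT.
rewrite !subquo_chainE; apply/predeqP => l; split.
  move/(ideal_chain_map (colonI^~ a)).
  have -> : colonI (addI (scaleI a setT) N) a = setT.
    apply/seteqP; split=> // r _; apply: subset_addIl => //; exists r => //.
    by rewrite mulrC.
  apply => [K iK|K K' iK iK' NK KK' K'I]; first exact: colonI_ideal.
  split; first by move=> r; exact: KK'.1.
  move=> sub; apply: KK'.2 => z K'z; have [_ [b [[r _ <-] Nb zE]]] := K'I z K'z.
  rewrite zE; apply: idealD => //; last exact: NK.
  rewrite mulrC; apply: sub; rewrite /colonI /=.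
  have -> : r * a = z - b by rewrite zE addrK mulrC.
  by apply: idealB => //; apply: KK'.1; exact: NK.
move/(ideal_chain_map (fun K => addI (scaleI a K) N)).
have -> : addI (scaleI a (colonI N a)) N = N.
  apply/seteqP; split; last by apply: subset_addIr; apply: scaleI_ideal; exact: colonI_ideal.
  by apply: addI_min => // _ [r Nr <-]; rewrite mulrC.
apply => [K iK|K K' iK iK' NK KK' _].
  by apply: addI_ideal => //; exact: scaleI_ideal.
split; first exact: addISl (scaleIS _ _ _ KK'.1).
move=> sub; apply: KK'.2 => z K'z.
have [|_ [n [[k Kk <-] Nn azE]]] := sub (a * z).
  by apply: subset_addIl => //; exists z.
rewrite -[z](subrK k); apply: idealD => //; apply: NK; rewrite /colonI /=.
by rewrite mulrC mulrBr azE addrC addKr.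
Qed.

Lemma finite_length_chainE {L N L' N'} : subquo_chain L N = subquo_chain L' N' ->
  finite_length L N = finite_length L' N'.
Proof. by rewrite /finite_length => ->. Qed.

Lemma subquo_length_chainE {L N L' N'} : subquo_chain L N = subquo_chain L' N' ->
  subquo_length L N = subquo_length L' N'.
Proof. by rewrite /subquo_length => ->. Qed.

End IdealArithmetic.

(** * Noetherian rings and criteria for finite length *)

Section Noetherian.
Context {A : comPzRingType}.
Hypothesis noethA : noetherian A.
Implicit Types (I J K L M N m : set A) (s : seq A).

Lemma subset_cons {T : eqType} (a : T) (s : seq T) : [set` s] `<=` [set` a :: s].
Proof. by move=> b /= bs; rewrite inE bs orbT. Qed.

(** The union of the chain is an ideal, and its finitely many generators all lie in one term. *)
Lemma noetherian_acc (c : nat -> set A) :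
  (forall n, is_ideal (c n)) -> (forall n, c n `<=` c n.+1) ->
  exists n, forall k, (n <= k)%N -> c k `<=` c n.
Proof.
move=> ic c_step.
have c_mono i j : (i <= j)%N -> c i `<=` c j.
  move=> /subnK <-; elim: (j - i)%N => [|n IH]; first exact: subset_refl.
  exact: subset_trans (c_step _).
have iU : is_ideal [set a | exists n, c n a].
  split; first by exists 0%N; exact: ideal0.
  - move=> a b [i ca] [j cb]; exists (maxn i j).
    apply: idealD => //; [apply: c_mono ca|apply: c_mono cb].
      exact: leq_maxl.
    exact: leq_maxr.
  - by move=> r a [i ca]; exists i; exact: idealMl.
have [s Us] := noethA _ iU.
have [n cn] : exists n, [set` s] `<=` c n.
  have : [set` s] `<=` [set a | exists n, c n a] by rewrite Us; exact: sub_ideal_span.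
  elim: s {Us} => [_|a s IH sU]; first by exists 0%N.
  have [j cj] := IH (subset_trans (subset_cons a s) sU).
  have [i ci] := sU a (mem_head a s).
  exists (maxn i j) => b /=; rewrite inE => /predU1P[->|bs].
    by apply: c_mono ci; exact: leq_maxl.
  by apply: c_mono (cj b bs); exact: leq_maxr.
exists n => k _ a ca; apply: (ideal_span_min _ _ (ic n) cn).
by rewrite -Us; exists k.
Qed.

Lemma noetherian_max (P : set A -> Prop) :
  (exists I, P I) -> (forall I, P I -> is_ideal I) ->
  exists2 M, P M & forall K, P K -> M `<=` K -> K = M.
Proof.
move=> [I PI] iP; apply: contrapT => nomax.
(* Keeping [P K] as a premise makes the relation total, as [choice] requires; iterating the choice
   function from [I] gives a strictly increasing chain. *)
have step K : exists K', P K -> P K' /\ K `<` K'.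
  have [PK|nPK] := pselect (P K); last by exists K.
  apply: contrapT => no; apply: nomax; exists K => // K' PK' KK'.
  apply: contrapT => K'K; apply: no; exists K' => _; split=> //; split=> // sub.
  by apply: K'K; apply/seteqP.
have [next nextP] := choice step.
have Pc n : P (iter n next I) by elim: n => //= n /nextP[].
have [n /(_ n.+1 (leqnSn n))] := noetherian_acc (fun n => iter n next I)
  (fun n => iP _ (Pc n)) (fun n => (nextP _ (Pc n)).2.1).
exact: (nextP _ (Pc n)).2.2.
Qed.

Lemma finite_length_maximal m : maximal_ideal m -> finite_length setT m.
Proof.
move=> [im m1 mmax]; apply: (finite_length_bounded 1) => // l mT.
move: mT; move eT : setT => T mT; case: mT eT => // K L l' mK iL [_ LK] LT.
have K1 : ~ K 1.
  by move=> K1; apply: LK => a _; rewrite -[a]mulr1; apply: idealMl => //;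
     exact: ideal_chain_idealr _ _ _ mK.
have KE : K = m := mmax K (ideal_chain_idealr _ _ _ mK) K1 (ideal_chain_sub _ _ _ mK).
by move: mK; rewrite KE => /ideal_chain_loop ->.
Qed.

(* Noetherian induction: if [a] is not in [N] and [N : a] is maximal among such
   colon ideals, then [N : a] is [m], so [(N + (a)) / N] is simple. *)
Lemma finite_colength m N : maximal_ideal m -> is_ideal N -> m `<=` radical N ->
  finite_length setT N.
Proof.
move=> mm iN0 mN0; apply: contrapT => nfN0.
have [||{iN0 mN0 nfN0}N [iN mN nfN] maxN] := noetherian_max
  (fun N => [/\ is_ideal N, m `<=` radical N & ~ finite_length setT N]).
- by exists N.
- by move=> I [].
have N1 : ~ N 1.
  move=> N1; apply: nfN; have -> : N = setT; last exact: finite_length_id.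
  by apply/seteqP; split=> // a _; rewrite -[a]mulr1; exact: idealMl.
have [||_ [a Na ->] maxa] := noetherian_max
  (fun I => exists2 a, ~ N a & I = colonI N a).
- by exists (colonI N 1), 1.
- by move=> _ [a _ ->]; exact: colonI_ideal.
have m_colon : m `<=` colonI N a.
  move=> s ms; have [k Nsk] := mN s ms; apply: contrapT => Nsa.
  (* If s a is not in N, maximality of N : a shows inductively that no s^j a is in N, although some
     power of s is. *)
  have powN j : ~ N (s ^+ j * a) /\ colonI N (s ^+ j * a) = colonI N a.
    elim: j => [|j [_ IH]]; first by rewrite expr0 mul1r.
    have nN : ~ N (s ^+ j.+1 * a).
      by move=> Nsja; apply: Nsa; rewrite -IH /colonI /= mulrA -exprS.
    split=> //; apply: maxa; first by exists (s ^+ j.+1 * a).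
    by move=> r; rewrite /colonI /= mulrCA => /idealMl; apply.
  by apply: (powN k).1; exact: idealMr.
have colonE : colonI N a = m.
  case: (mm) => _ _; apply => //; first exact: colonI_ideal.
  by rewrite /colonI /= mul1r.
have iaT : is_ideal (scaleI a setT) by exact: scaleI_ideal.
have NM : N `<=` addI (scaleI a setT) N by exact: subset_addIr.
have iM : is_ideal (addI (scaleI a setT) N) by exact: addI_ideal.
(* (N + (a))/N is a copy of A/m, and A/(N + (a)) has finite length by maximality of N, since a is
   not in N. *)
apply: nfN; apply: (finite_length_trans NM) => //.
  rewrite (finite_length_chainE (subquo_chain_scaleI _ _ iN)) colonE.
  exact: finite_length_maximal.
apply: contrapT => nfM; apply: Na.
rewrite -(maxN (addI (scaleI a setT) N)) //.
  by apply: subset_addIl => //; exists 1 => //; rewrite mulr1.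
by split=> // s /mN[k Nsk]; exists k; exact: NM.
Qed.

(** Adjoin the generators of L to N one at a time: each new generator contributes a cyclic module
    that is a quotient of A/J. *)
Lemma finite_length_annihilated J L N : is_ideal L -> is_ideal N -> N `<=` L ->
  finite_length setT J -> (forall a, L a -> J `<=` colonI N a) -> finite_length L N.
Proof.
move=> iL iN NL fJ JL.
have [s Ls] := noethA _ iL.
have sL : [set` s] `<=` L by rewrite Ls; exact: sub_ideal_span.
suff [M [iM NM sM fM]] : exists M,
    [/\ is_ideal M, N `<=` M, [set` s] `<=` M & finite_length M N].
  apply: (finite_lengthl _ _ _ fM) => //.
  by rewrite Ls; exact: ideal_span_min.
elim: s {Ls} sL => [_|a s IH sL].
  by exists N; split=> //; exact: finite_length_id.
have [M [iM NM sM fM]] := IH (subset_trans (subset_cons a s) sL).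
have iaT : is_ideal (scaleI a setT) by exact: scaleI_ideal.
have MM' : M `<=` addI (scaleI a setT) M by exact: subset_addIr.
exists (addI (scaleI a setT) M); split.
- exact: addI_ideal.
- exact: subset_trans MM'.
- move=> b /=; rewrite inE => /predU1P[->|/sM/MM'//].
  by apply: subset_addIl => //; exists 1 => //; rewrite mulr1.
- apply: (finite_length_trans NM MM' fM).
  rewrite (finite_length_chainE (subquo_chain_scaleI _ _ iM)).
  apply: (finite_lengthr _ _ _ fJ) => //; first exact: colonI_ideal.
  move=> r Jr; apply: NM; apply: JL Jr; apply: sL; exact: mem_head.
Qed.

End Noetherian.

(** * Multiplication by y modulo (x), and the ideals (y^n) + (x) *)

Section ParameterIdeal.
Context {A : comPzRingType} (x y : A).
Implicit Types (B : set A).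

Let X : set A := scaleI x setT.
Let J : set A := addI (scaleI y setT) X.
Let W : set A := colonI X y.

Hypotheses (finJ : finite_length setT J) (finW : finite_length W X).

Let iX : is_ideal X. Proof. exact: scaleI_ideal. Qed.
Let iyT : is_ideal (scaleI y setT). Proof. exact: scaleI_ideal. Qed.
Let iJ : is_ideal J. Proof. exact: addI_ideal. Qed.
Let iW : is_ideal W. Proof. exact: colonI_ideal. Qed.
Let XW : X `<=` W. Proof. exact: subset_colonI. Qed.

(* The Euler characteristic of multiplication by y on the ideal B/(x) of A/(x)
   does not depend on B. *)
Lemma euler_char_scale B : is_ideal B -> X `<=` B -> finite_length setT B ->
  finite_length setT (addI (scaleI y B) X) /\
  (subquo_length B (addI (scaleI y B) X) + subquo_length W X =
   subquo_length setT J + subquo_length (W `&` B) X)%N.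
Proof.
move=> iB XB fB; set N := addI (scaleI y B) X.
have iyB : is_ideal (scaleI y B) by exact: scaleI_ideal.
have iN : is_ideal N by exact: addI_ideal.
have NJ : N `<=` J by apply: addISl; exact: scaleIS.
have NB : N `<=` B by apply: addI_min => //; exact: scaleI_sub_id.
have JE : addI (scaleI y setT) N = J.
  apply/seteqP; split; first by apply: addI_min => //; exact: subset_addIl.
  apply: addI_min; [exact: addI_ideal|exact: subset_addIl|].
  by apply: subset_trans (subset_addIr _ _ iyT); exact: subset_addIr.
have NyE : colonI N y = addI W B.
  apply/seteqP; split; last first.
    apply: addI_min; first exact: colonI_ideal.
      by move=> w Ww; apply: subset_addIr.
    by move=> b Bb; apply: subset_addIl => //; exists b => //; rewrite mulrC.
  move=> r [_ [c [[b Bb <-] Xc ryE]]]; exists (r - b), b; split; rewrite ?subrK //.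
  by rewrite /W /colonI /= mulrBl ryE mulrC addrAC subrr add0r.
(* J/N is isomorphic to A/(W + B). The identity then follows from additivity along N, J, A; N, B, A;
   B, W + B, A; and X, W /\ B, W, as (W + B)/B is W/(W /\ B). *)
have chJN := subquo_chain_scaleI y N iN; rewrite JE NyE in chJN.
have BWB : B `<=` addI W B by exact: subset_addIr.
have iWB : is_ideal (addI W B) by exact: addI_ideal.
have fWB := finite_lengthr iWB BWB (@subsetT _ _) fB.
have fJN : finite_length J N by rewrite (finite_length_chainE chJN).
have fN := finite_length_trans NJ (@subsetT _ J) fJN finJ.
split=> //.
have XWB : X `<=` W `&` B by move=> a Xa; split; [exact: XW|exact: XB].
have := subquo_lengthD iJ NJ (@subsetT _ J) fN.
have := subquo_lengthD iB NB (@subsetT _ B) fN.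
have := subquo_lengthD iWB BWB (@subsetT _ _) fB.
have := subquo_lengthD (idealI iW iB) XWB (@subIsetl _ W B) finW.
rewrite (subquo_length_chainE chJN).
rewrite (subquo_length_chainE (subquo_chain_addI _ _ iW iB)); lia.
Qed.

Definition powerI n : set A := addI (scaleI (y ^+ n) setT) X.

Let iY n : is_ideal (powerI n).
Proof. by apply: addI_ideal => //; exact: scaleI_ideal. Qed.

Lemma powerI0 : powerI 0 = setT.
Proof.
apply/seteqP; split=> // a _; apply: subset_addIl => //.
by exists a => //; rewrite expr0 mul1r.
Qed.

Lemma powerIS n : powerI n.+1 = addI (scaleI y (powerI n)) X.
Proof.
have iSY : is_ideal (scaleI y (powerI n)) by exact: scaleI_ideal.
apply/seteqP; split; apply: addI_min.
- exact: addI_ideal.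
- move=> _ [r _ <-]; apply: subset_addIl => //; exists (y ^+ n * r).
    by apply: subset_addIl => //; exists r.
  by rewrite exprS mulrA.
- exact: subset_addIr.
- exact: iY.
- move=> _ [_ [_ [c [[r _ <-] Xc ->]]] <-]; exists (y ^+ n.+1 * r), (y * c).
  by split; [exists r|exact: idealMl|rewrite exprS mulrDr mulrA].
- by apply: subset_addIr; exact: scaleI_ideal.
Qed.

(** Take B = [powerI n] in the Euler characteristic identity and discard the length of (W /\ B)/X.
    The bound is n (l(A/J) - l(W/X)), rearranged to avoid subtraction in [nat]. *)
Lemma powerI_colength n : finite_length setT (powerI n) /\
  (n * subquo_length setT J <= subquo_length setT (powerI n) + n * subquo_length W X)%N.
Proof.
elim: n => [|n [fYn IH]]; first by rewrite powerI0; split; [exact: finite_length_id|].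
have iyn : is_ideal (scaleI (y ^+ n) setT) by exact: scaleI_ideal.
have XY : X `<=` powerI n by exact: subset_addIr.
have [] := euler_char_scale _ (iY n) XY fYn; rewrite -powerIS => fYS eul; split=> //.
have YY : powerI n.+1 `<=` powerI n.
  by rewrite powerIS; apply: addI_min => //; exact: scaleI_sub_id.
have := subquo_lengthD (iY n) YY (@subsetT _ _) fYS; nia.
Qed.

Lemma powerI_colon_stable : noetherian A ->
  exists n0, forall n, (n0 <= n)%N -> W `&` powerI n `<=` X.
Proof.
move=> noethA.
have [||n0 n0P] := noetherian_acc noethA (fun n => colonI X (y ^+ n)).
- by move=> n; exact: colonI_ideal.
- by move=> n a /= Xa; rewrite /colonI /= exprS mulrCA; exact: idealMl.
exists n0 => n n0n z [+ [_ [c [[a _ <-] Xc zE]]]]; rewrite {}zE => Wz.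
(* The element is z = y^n a + c with c in X; since y z is in X, a lies in X : y^(n+1), which is
   contained in X : y^n0. Hence y^n a is in X. *)
have Xa : colonI X (y ^+ n0) a.
  apply: (n0P n.+1); first exact: leqW.
  move: Wz; rewrite /W /colonI /= mulrDl => Xz.
  have -> : a * y ^+ n.+1 = (y ^+ n * a * y + c * y) - c * y.
    by rewrite addrK exprSr mulrC mulrAC.
  by apply: idealB => //; exact: idealMr.
apply: idealD => //; rewrite -(subnK n0n) exprD -mulrA; apply: idealMl => //.
by rewrite mulrC.
Qed.

End ParameterIdeal.

(** * Stationary partial sums and uniqueness of the Hilbert coefficients *)

Section HilbertPolynomial.

(** Induction on a bound [d] for the gap [u - S N]: every increase of [S] lowers the gap by at least
    one. *)
Lemma bounded_nondecreasing_stationary (S : nat -> int) (u : int) N :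
  (forall n, (N <= n)%N -> S n <= S n.+1) -> (forall n, (N <= n)%N -> S n <= u) ->
  exists M, forall n, (M <= n)%N -> S n = S M.
Proof.
move=> mono bnd; have [d] : exists d : nat, u - S N <= d%:Z.
  by exists (absz (u - S N)); lia.
elim: d N mono bnd => [|d IH] N mono bnd le_d.
all: have SN_le n : (N <= n)%N -> S N <= S n
  by move=> /subnK <-; elim: (n - N)%N => // k IHk;
     rewrite addSn (le_trans IHk) // mono // leq_addl.
  by exists N => n Nn; have := SN_le n Nn; have := bnd n Nn; lia.
have [const|] := pselect (forall n, (N <= n)%N -> S n = S N); first by exists N.
move/existsNP => [n /not_implyP[Nn SnN]]; apply: (IH n).
- by move=> i ni; apply: mono; exact: leq_trans ni.
- by move=> i ni; apply: bnd; exact: leq_trans ni.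
- by have := SN_le n Nn; lia.
Qed.

Lemma sum_from1_stationary (f : nat -> int) N :
  (forall n, (N <= n)%N -> \sum_(1 <= i < n.+1) f i = \sum_(1 <= i < N.+1) f i) ->
  is_sum_from1 f (\sum_(1 <= i < N.+1) f i).
Proof.
move=> fN; exists N.+1 => -[//|n]; rewrite ltnS => Nn.
exact: fN.
Qed.

Lemma chern_numberE (R : comNzRingType) (F : filtration R) e0 e1 e2 :
  hilbert_coeffs F (e0, e1, e2) -> chern_number F = e1.
Proof.
move=> hF; rewrite /chern_number; case: xgetP => [[[d0 d1] d2] _ /= [M HM]|/(_ _ hF)//].
case: hF => [N HN]; pose n := maxn M N.
have Mn : (M <= n)%N by exact: leq_maxl.
have Nn : (N <= n)%N by exact: leq_maxr.
have H i : d0 * 'C((i + n).+1, 2)%:Z - d1 * (i + n)%:Z + d2 =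
           e0 * 'C((i + n).+1, 2)%:Z - e1 * (i + n)%:Z + e2.
  have [_ <-] := HM (i + n)%N ltac:(lia).
  by have [_ <-] := HN (i + n)%N ltac:(lia).
(* The second difference of the three consecutive values gives [d0 = e0], and then a first
   difference gives [d1 = e1]. *)
have := H 0%N; have := H 1%N; have := H 2%N; rewrite !add0n !addSn !binS !bin1 !bin0.
set b := 'C(n, 2); move: (b) => {}b h2 h1 h0.
have : d0 = e0 by lia.
by move=> d0e0; subst; lia.
Qed.

End HilbertPolynomial.

(** * Partial sums of the series and the Hilbert function *)

Section RegularFiltration.
Context {A : comPzRingType} (x y : A) (G : nat -> set A).

Let X : set A := scaleI x setT.
Let J : set A := addI (scaleI y setT) X.
Let W : set A := colonI X y.

Hypotheses (noethA : noetherian A) (finJ : finite_length setT J)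
  (finW : finite_length W X).
Hypotheses (idealG : forall n, is_ideal (G n)) (G0 : G 0 = setT)
  (decG : forall n, G n.+1 `<=` G n)
  (scaleG : forall n, scaleI y (G n) `<=` G n.+1)
  (colonG : forall n, colonI (G n.+1) x = G n)
  (finG : forall n, finite_length setT (G n)).
Variable k : nat.
Hypothesis powerG : forall n, G (k + n) `<=` powerI x y n.

(* The summand of index n + 1 of the series in the theorem. *)
Definition defect n : int :=
  (subquo_length (G n.+1) (addI (scaleI y (G n)) (scaleI x (G n))))%:Z -
  (subquo_length (W `&` G n) (X `&` G n))%:Z.

Let B n : set A := addI X (G n).
Let L n := subquo_length setT (B n).
Let c : int := (subquo_length setT J)%:Z - (subquo_length W X)%:Z.

Let iX : is_ideal X. Proof. exact: scaleI_ideal. Qed.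
Let iW : is_ideal W. Proof. exact: colonI_ideal. Qed.
Let iB n : is_ideal (B n). Proof. exact: addI_ideal. Qed.
Let XB n : X `<=` B n. Proof. exact: subset_addIl. Qed.
Let GB n : G n `<=` B n. Proof. exact: subset_addIr. Qed.
Let finB n : finite_length setT (B n).
Proof. exact: finite_lengthr (iB n) (GB n) (@subsetT _ _) (finG n). Qed.

Let BS n : B n.+1 `<=` B n.
Proof. by apply: addI_min => //; apply: subset_trans (GB n). Qed.

Let L0 : L 0 = 0%N.
Proof.
rewrite /L; have -> : B 0 = setT; last exact: subquo_length_id.
by apply/seteqP; split=> // a _; apply: GB; rewrite G0.
Qed.

(** [B n.+1] modulo [G n.+1] is a copy of A/([G n.+1] : x) = A/[G n]. *)
Let HS n : subquo_length setT (G n.+1) = (L n.+1 + subquo_length setT (G n))%N.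
Proof.
rewrite (subquo_lengthD (iB n.+1) (GB n.+1) (@subsetT _ _) (finG _)).
by rewrite (subquo_length_chainE (subquo_chain_scaleI _ _ (idealG _))) colonG.
Qed.

(** As W contains X, the modular law gives W /\ (X + G_n) = (W /\ G_n) + X, and the second
    isomorphism theorem applies. *)
Let cap_colon n : subquo_length (W `&` B n) X = subquo_length (W `&` G n) (X `&` G n).
Proof.
have -> : W `&` B n = addI (W `&` G n) X.
  apply/seteqP; split; last first.
    apply: addI_min; first exact: idealI.
      by move=> a [Wa Ga]; split=> //; exact: GB.
    by move=> a Xa; split; [exact: subset_colonI|exact: XB].
  move=> z [Wz [a [b [Xa Gb zE]]]]; exists b, a; split=> //; last by rewrite zE addrC.
  split=> //; have -> : b = z - a by rewrite zE addrC addKr.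
  by apply: idealB => //; exact: subset_colonI.
rewrite (subquo_length_chainE (subquo_chain_addI _ _ (idealI iW (idealG n)) iX)).
by rewrite setIAC (setIidr (subset_colonI y iX)).
Qed.

Lemma cap_colon_finite n : finite_length (W `&` G n) (X `&` G n).
Proof.
have := subquo_chain_addI _ _ (idealI iW (idealG n)) iX.
rewrite setIAC (setIidr (subset_colonI y iX)) => /finite_length_chainE <-.
apply: finite_lengthl finW.
- by apply: addI_ideal => //; exact: idealI.
- by apply: subset_addIr; exact: idealI.
- by apply: addI_min; [|exact: subIsetl|exact: subset_colonI].
Qed.

(** With N = y B_n + X, the quotient B_(n+1)/N is isomorphic to G_(n+1)/(y G_n + x G_n). The Euler
    characteristic identity for B_n supplies the length of B_n/N. *)
Let defectE n : defect n = c - (L n.+1)%:Z + (L n)%:Z.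
Proof.
have [] := euler_char_scale x y finJ finW (B n) (iB n) (XB n) (finB n).
rewrite -/X -/J -/W; set N := addI (scaleI y (B n)) X => fN eul.
have iN : is_ideal N by apply: addI_ideal => //; exact: scaleI_ideal.
have NB : N `<=` B n.+1.
  apply: addI_min => // _ [_ [a [b [Xa Gb ->]]] <-]; rewrite mulrDr.
  apply: idealD => //; first by apply: XB; exact: idealMl.
  by apply: GB; apply: scaleG; exists b.
have BE : B n.+1 = addI (G n.+1) N.
  apply/seteqP; split; last by apply: addI_min => //; exact: GB.
  apply: addI_min; [exact: addI_ideal| |exact: subset_addIl].
  apply: subset_trans (subset_addIr _ _ (idealG _)).
  by apply: subset_addIr; exact: scaleI_ideal.
(* An element of the left side is y g + x t with g in G_n. Since y g is in G_(n+1), so is x t, and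
   [colonG] puts t in G_n. *)
have GN : G n.+1 `&` N = addI (scaleI y (G n)) (scaleI x (G n)).
  apply/seteqP; split; last first.
    apply: addI_min; first exact: idealI.
      move=> _ [g Gg <-]; split; first by apply: scaleG; exists g.
      apply: subset_addIl => //; exists g => //; exact: GB.
    move=> _ [g Gg <-]; split; first by rewrite -(colonG n) /colonI /= mulrC in Gg.
    by apply: subset_addIr; [exact: scaleI_ideal|exists g].
  move=> z [Gz [_ [_ [[_ [_ [g [[r _ <-] Gg ->]]] <-] [s _ <-] zE]]]].
  exists (y * g), (x * (y * r + s)); split; [by exists g| |by rewrite zE; ring].
  exists (y * r + s) => //; rewrite -(colonG n) /colonI /=.
  have -> : (y * r + s) * x = z - y * g by rewrite zE; ring.
  by apply: idealB => //; apply: scaleG; exists g.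
have := subquo_lengthD (iB n) (@BS n) (@subsetT _ _) (finB n.+1).
have := subquo_lengthD (iB n.+1) NB (@BS n)
  (finite_lengthl (iB n) (subset_trans NB (@BS n)) (@subsetT _ _) fN).
have := subquo_length_chainE (subquo_chain_addI _ _ (idealG n.+1) iN).
rewrite -BE GN /defect => <-; move: eul; rewrite cap_colon /c /L; lia.
Qed.

(** The differences of [L] telescope down to [L 0] = 0. *)
Let sum_defect n : \sum_(1 <= i < n.+1) defect i.-1 = c * n%:Z - (L n)%:Z.
Proof.
elim: n => [|n IH]; first by rewrite big_geq // L0 mulr0 subr0.
by rewrite big_nat_recr //= IH defectE; lia.
Qed.

Let sum_defect_le n : (k <= n)%N -> \sum_(1 <= i < n.+1) defect i.-1 <= c * k%:Z.
Proof.
move=> /subnKC <-; set j := (n - k)%N; rewrite sum_defect.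
have [fY] := powerI_colength x y finJ finW j.
have BY : B (k + j) `<=` powerI x y j.
  apply: addI_min => //; first by apply: addI_ideal => //; exact: scaleI_ideal.
  by apply: subset_addIr; exact: scaleI_ideal.
have iY : is_ideal (powerI x y j) by apply: addI_ideal => //; exact: scaleI_ideal.
have := subquo_lengthD iY BY (@subsetT _ _) (finB (k + j)).
rewrite -/X -/J -/W -/(L _) PoszD /c; nia.
Qed.

Let defect_ge0 : exists N, forall n, (N <= n)%N -> 0 <= defect n.
Proof.
have [n0 n0P] := powerI_colon_stable x y noethA.
exists (k + n0)%N => n n0n; rewrite /defect -cap_colon.
(* B_n is contained in (y^(n-k)) + (x), whose intersection with W is in X; so the subtracted length
   vanishes. *)
have -> : W `&` B n = X; last by rewrite (subquo_length_id iX) subr0.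
have [kn n0k] : (k <= n)%N /\ (n0 <= n - k)%N by lia.
apply/seteqP; split.
  apply: subset_trans (n0P _ n0k); apply: setIS.
  apply: addI_min; first by apply: addI_ideal => //; exact: scaleI_ideal.
    by apply: subset_addIr; exact: scaleI_ideal.
  by rewrite -{1}(subnKC kn); exact: powerG.
by move=> a Xa; split; [exact: subset_colonI|exact: XB].
Qed.

Lemma sum_defect_hilbert : exists e0 e1 e2 : int,
  is_sum_from1 (fun n => defect n.-1) e1 /\
  exists N, forall n, (N <= n)%N ->
    (subquo_length setT (G n))%:Z = e0 * 'C(n.+1, 2)%:Z - e1 * n%:Z + e2.
Proof.
have [N0 def_ge0] := defect_ge0.
pose S n := \sum_(1 <= i < n.+1) defect i.-1.
have [||M SM] := bounded_nondecreasing_stationary S (c * k%:Z) (maxn N0 k).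
- by move=> n Nn; rewrite /S [leRHS]big_nat_recr //= lerDl def_ge0 //; lia.
- by move=> n Nn; apply: sum_defect_le; lia.
(* The constant term makes the formula exact at [M]. Beyond [M] the Hilbert function grows by L(n+1)
   = c (n+1) - S(M), as does the polynomial. *)
exists c, (S M), ((subquo_length setT (G M))%:Z - c * 'C(M.+1, 2)%:Z + S M * M%:Z).
split; first exact: sum_from1_stationary.
exists M => n /subnK <-; elim: (n - M)%N => [|j IH]; first by rewrite add0n; lia.
have := SM (j + M).+1 ltac:(lia); rewrite {1}/S sum_defect => LE.
rewrite addSn HS PoszD IH [in RHS]binS bin1; nia.
Qed.

End RegularFiltration.

(** * Initial forms in the associated graded ring *)

Section FiltrationElements.
Context {R : comNzRingType} (F : filtration R).

Lemma fil_decn i j : (i <= j)%N -> F j%:Z `<=` F i%:Z.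
Proof.
move=> /subnK <-; elim: (j - i)%N => // n IH a; rewrite addSn -addn1 PoszD.
by move=> /fil_dec /IH.
Qed.

(** Serves the first summand of the series, where the index n - 2 is -1. *)
Lemma fil_N1 : F (- 1) = setT.
Proof.
by apply/seteqP; split=> // a _; apply: fil_dec; rewrite addNr fil0.
Qed.

Lemma rees_monomial n a : F n%:Z a -> a *: 'X^n \in rees_pred F.
Proof.
move=> Fa; apply/asboolP => i; rewrite coefZ coefXn.
by case: eqP => [->|_]; rewrite ?mulr1 // mulr0; exact: fil_0.
Qed.

Lemma val_initial_form n a : F n%:Z a ->
  exists p, initial_form F n a = to_gr p /\ val p = a *: 'X^n.
Proof.
move=> Fa; exists (insubd 0 (a *: 'X^n)); split=> //.
by rewrite insubdK //; exact: rees_monomial.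
Qed.

Lemma initial_form_eq0 n a : F n%:Z a ->
  initial_form F n a = 0 <-> F (n%:Z + 1) a.
Proof.
move=> Fa; have [p [-> pE]] := val_initial_form n a Fa.
have to_gr0 : @to_gr R F 0 = 0.
  by apply: (addrI (to_gr 0)); rewrite -to_grD !addr0.
rewrite -to_gr0 to_grE subr0; split=> [/asboolP/(_ n)|Fna].
  by rewrite pE coefZ coefXn eqxx mulr1.
apply/asboolP => i; rewrite pE coefZ coefXn.
by case: eqP => [->|_]; rewrite ?mulr1 // mulr0; exact: fil_0.
Qed.

Lemma initial_formM i j a b : F i%:Z a -> F j%:Z b ->
  initial_form F i a * initial_form F j b = initial_form F (i + j) (a * b).
Proof.
move=> Fa Fb; have [p [-> pE]] := val_initial_form i a Fa.
have [q [-> qE]] := val_initial_form j b Fb.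
have [|r [-> rE]] := val_initial_form (i + j) (a * b).
  by rewrite PoszD; exact: fil_mul.
rewrite [LHS]to_gr_mul; congr to_gr; apply: val_inj.
by rewrite rmorphM /= pE qE rE -scalerAl -scalerAr scalerA exprD.
Qed.

(** Climb the filtration up to degree n: if a is in F_j with j < n, then x a is in F_(n+1), hence in
    F_(j+2). So the product of the initial forms of x and a is zero, and regularity puts a in
    F_(j+1). *)
Lemma regular_colon x n : F 1 x -> GRing.lreg (initial_form F 1 x) ->
  colonI (F n.+1%:Z) x = F n%:Z.
Proof.
move=> Fx regx; apply/seteqP; split=> a; rewrite /colonI /=; last first.
  by move=> Fa; rewrite -addn1 PoszD; exact: fil_mul.
rewrite mulrC => Fxa; have: (n <= n)%N by [].
elim: {1 3}n => [_|j IH jn]; first by rewrite fil0.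
have Fa := IH (ltnW jn); rewrite -addn1 PoszD.
apply/(initial_form_eq0 _ _ Fa)/regx; rewrite mulr0 initial_formM //.
apply/initial_form_eq0; first by rewrite PoszD; exact: fil_mul.
by apply: fil_decn Fxa; lia.
Qed.

End FiltrationElements.

(** * Application to an admissible filtration *)

Theorem theorem3p2 (R : comNzRingType) (m : set R) (x y : R) (F : filtration R)
  (J := ideal_span [set x; y])
  (noethR : noetherian R) (localR : local_ring m) (dimR : krull_dim_is R 2)
  (infinite_residue : infinite_set (cosets m))
  (paramJ : system_of_parameters m [:: x; y])
  (admF : admissible J F)
  (depthG : (1 <= depth (gr_max F m))%N)
  (regx : GRing.lreg (initial_form F 1 x)) :
  (forall n : nat, (1 <= n)%N ->
     finite_length (F n%:Z) (idealM J (F (n%:Z - 1))) /\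
     finite_length (colon x y `&` F (n%:Z - 1))
                   (idealM (ideal_span [set x]) (F (n%:Z - 2)))) /\
  is_sum_from1
    (fun n : nat =>
       (subquo_length (F n%:Z) (idealM J (F (n%:Z - 1))))%:Z -
       (subquo_length (colon x y `&` F (n%:Z - 1))
                      (idealM (ideal_span [set x]) (F (n%:Z - 2))))%:Z)
    (chern_number F).
Proof.
have [k admFk] := admF.
have iF := fil_ideal F; have iJ : is_ideal J by exact: ideal_span_ideal.
have JE : J = addI (scaleI y setT) (scaleI x setT) by exact: ideal_span2.
have JF n : idealX J n%:Z `<=` F n%:Z by have [] := admFk n%:Z.
have iJX n : is_ideal (idealX J n%:Z) by case: n => // n; exact: idealM_ideal.
have JX1 a : J a -> F 1 a.
  by move=> Ja; apply: JF; rewrite -[a]mulr1; exact: mem_idealM.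
have Fx : F 1 x by apply: JX1; apply: sub_ideal_span; left.
have Fy : F 1 y by apply: JX1; apply: sub_ideal_span; right.
have colonF n : colonI (F n.+1%:Z) x = F n%:Z by exact: regular_colon.
have radJ a : m a -> exists i, J (a ^+ i).
  case: paramJ => _; have -> : [set` [:: x; y]] = [set x; y]; last by move=> <-.
  apply/seteqP; split=> b /=; rewrite !inE; first by move=> /orP[]/eqP->; [left|right].
  by move=> [->|->]; rewrite eqxx ?orbT.
(* If a^i is in J then a^(i n) is in J^n, so the radical of I contains m. *)
have colength n I : is_ideal I -> idealX J n%:Z `<=` I -> finite_length setT I.
  move=> iI JI; apply: (finite_colength noethR _ _ localR.1 iI) => a /radJ[i Jai].
  exists (i * n)%N; apply: JI; rewrite exprM; elim: n => // n IH.
  by rewrite exprS; exact: mem_idealM.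
have finJ : finite_length setT (addI (scaleI y setT) (scaleI x setT)).
  rewrite -JE; apply: (colength 1%N) => //.
  by apply: idealM_min => // a b Ja _; exact: (idealMr _ _ iJ Ja).
have iX : is_ideal (scaleI x setT) by exact: scaleI_ideal.
(* J annihilates ((x) : y)/(x), because both x and y do. *)
have finW : finite_length (colonI (scaleI x setT) y) (scaleI x setT).
  apply: (finite_length_annihilated noethR _ _ _ _ _ _ finJ) => //; first exact: colonI_ideal.
    exact: subset_colonI.
  move=> a Xay _ [_ [_ [[r _ <-] [s _ <-] ->]]]; rewrite /colonI /=.
  have -> : (y * r + x * s) * a = r * (a * y) + x * (s * a) by ring.
  by apply: idealD => //; [exact: idealMl|exists (s * a)].
have scaleF n : scaleI y (F n%:Z) `<=` F n.+1%:Z.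
  by move=> _ [a Fa <-]; rewrite -add1n PoszD; exact: fil_mul.
have finF n : finite_length setT (F n%:Z) by exact: colength (JF n).
(* Admissibility puts F_(k+n) inside J^n, and modulo (x) the ideal J is generated by y. *)
have powerF n : F (k + n)%N%:Z `<=` powerI x y n.
  have [_] := admFk (k + n)%N%:Z; have -> : (k + n)%N%:Z - k%:Z = n%:Z by lia.
  move/subset_trans; apply; elim: n => [|n IH]; first by rewrite powerI0.
  rewrite powerIS; apply: idealM_min.
    by apply: addI_ideal => //; apply: scaleI_ideal; apply: addI_ideal => //;
       exact: scaleI_ideal.
  move=> a b + /IH Yb; rewrite JE => -[_ [_ [[r _ <-] [s _ <-] ->]]].
  exists (y * (r * b)), (x * (s * b)); split; last by ring.
    exists (r * b) => //; apply: idealMl => //.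
    by apply: addI_ideal => //; exact: scaleI_ideal.
  by exists (s * b).
(* Regularity gives x F_(n-1) = (x) /\ F_n, which turns the denominator in the theorem into that of
   [defect]; for n = 0 both sides are (x). *)
have capF n : idealM (ideal_span [set x]) (F (n%:Z - 1)) = scaleI x setT `&` F n%:Z.
  rewrite idealM_span1 //; case: n => [|n].
    by rewrite sub0r fil_N1 fil0 setIT.
  have -> : n.+1%:Z - 1 = n%:Z by lia.
  apply/seteqP; split=> [_ [a Fa <-]|_ [[a _ <-] Fxa]].
    by split; [exists a|rewrite -colonF /colonI /= mulrC in Fa].
  by exists a => //; rewrite -colonF /colonI /= mulrC.
have colonE : colon x y = colonI (scaleI x setT) y by rewrite /colon ideal_span1.
have shift n : (n.+1%:Z - 1 = n%:Z) * (n.+1%:Z - 2 = n%:Z - 1) by split; lia.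
have decF n : F n.+1%:Z `<=` F n%:Z by exact: fil_decn.
split.
  case=> // n _; rewrite !shift capF colonE; split; last first.
    exact: (cap_colon_finite x y (fun i => F i%:Z) finW (fun i => iF i%:Z)).
  apply: (@finite_lengthl _ _ _ setT) => //.
    apply: idealM_min => // a b /JX1 Fa Fb; rewrite -add1n PoszD; exact: fil_mul.
  (* J F_n contains J J^n, so it already has finite colength in R. *)
  apply: (colength n.+1); first exact: idealM_ideal.
  by apply: idealM_min => [|a b Ja /(JF n) Fb]; [exact: idealM_ideal|exact: (mem_idealM _ _ Ja Fb)].
have [e0 [e1 [e2 [sum_e1 [N HN]]]]] := sum_defect_hilbert x y (fun n => F n%:Z)
  noethR finJ finW (fun n => iF n%:Z) (fil0 F) decF scaleF colonF finF k powerF.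
have -> : chern_number F = e1.
  by apply: (@chern_numberE _ _ e0 _ e2); exists N => n Nn; split; [|exact: HN].
case: sum_e1 => M HM; exists M => n /HM <-.
apply: eq_big_nat => -[//|i] _ /=.
by rewrite !shift capF colonE /defect /J idealM_span2.
Qed.
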